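(* Every co-existentially closed continuum is an indecomposable continuum of (Lebesgue covering) dimension one.
   Context: A compactum is a compact Hausdorff space; a continuum is a connected compactum. A continuum is indecomposable if it is not the union of two proper subcontinua. For a compactum $X$ and an ultrafilter $\mathcal{D}$ on a set $I$, the ultracopower $XI\backslash\mathcal{D}$ is the subspace of $\beta(X\times I)$ ($I$ discrete) of points mapped to $\mathcal{D}\in\beta(I)$ by the Stone–Čech extension of the projection to $I$; the codiagonal $p_{X,\mathcal{D}}:XI\backslash\mathcal{D}\to X$ is the restriction of the Stone–Čech extension of the projection $X\times I\to X$. A continuous map $f:X\to Y$ is co-elementary if there are ultrafilters $\mathcal{D}$ on $I$, $\mathcal{E}$ on $J$ and a homeomorphism $h:XI\backslash\mathcal{D}\to YJ\backslash\mathcal{E}$ with $f\circ p_{X,\mathcal{D}}=p_{Y,\mathcal{E}}\circ h$. A function $f:X\to Y$ between compacta is co-existential (of level $\geq1$) if it is a continuous surjection and there are a compactum $Z$, a co-elementary map $g:Z\to Y$ and a continuous surjection $h:Z\to X$ with $g=f\circ h$. A continuum $X$ is co-existentially closed (in the class of continua) if every continuous surjection from a continuum onto $X$ is co-existential. *)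

(* Defs.v *)
From HB Require Import structures.
From mathcomp Require Import all_boot all_order all_algebra.
From mathcomp Require Import mathcomp_extra boolp classical_sets functions.
From mathcomp Require Import cardinality reals topology normedtype.

Set Implicit Arguments.
Unset Strict Implicit.
Unset Printing Implicit Defensive.
Import Order.TTheory GRing.Theory Num.Theory.
Import numFieldNormedType.Exports.

Local Open Scope classical_set_scope.
Local Open Scope ring_scope.

Definition compactum (X : topologicalType) : Prop :=
  compact [set: X] /\ hausdorff_space X.

(* The empty space, which satisfies [connected], is not a continuum. *)
Definition continuum (X : topologicalType) : Prop :=
  [/\ compactum X, connected [set: X] & [set: X] !=set0].

Definition subcontinuum (X : topologicalType) (A : set X) : Prop :=
  [/\ closed A, connected A & A !=set0].

Definition indecomposable_continuum (X : topologicalType) : Prop :=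
  continuum X /\
  ~ exists A B : set X, [/\ subcontinuum A, subcontinuum B,
      A <> [set: X], B <> [set: X] & A `|` B = [set: X]].

Definition continuous_surjection (X Y : topologicalType) (f : X -> Y) : Prop :=
  continuous f /\ range f = [set: Y].

Definition homeomorphism (X Y : topologicalType) (h : X -> Y) : Prop :=
  continuous h /\
  exists k : Y -> X, [/\ continuous k, cancel h k & cancel k h].

Definition open_cover (X : topologicalType) (U : set (set X)) : Prop :=
  (forall A, U A -> open A) /\ \bigcup_(A in U) A = [set: X].

(* Every finite open cover has a finite open refinement, no point of which is
   in more than [m] members. For [m = n + 1] this is "dim X <= n"; for [m = 0]
   it says that [X] is empty. *)
Definition covering_multiplicity_le (m : nat) (X : topologicalType) : Prop :=
  forall U : set (set X), finite_set U -> open_cover U ->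
  exists V : set (set X), [/\ finite_set V, open_cover V,
    (forall B, V B -> exists2 A, U A & B `<=` A) &
    (forall x, ([set B | V B /\ B x] #<= `I_m)%card)].

Definition covering_dimension (X : topologicalType) (n : nat) : Prop :=
  covering_multiplicity_le n.+1 X /\ ~ covering_multiplicity_le n X.

(* The Stone-Cech compactification of [T]: the closure of the image of [T] in
   the product of copies of the line indexed by the continuous functions
   T -> [0, 1]. *)
Section StoneCech.
Context (R : realType) (T : topologicalType).

Definition unit_functions : set (T -> R) :=
  [set f : T -> R | continuous f /\ forall t, 0 <= f t <= 1].

Definition sc_evaluation (t : T) : prod_topology (fun _ : unit_functions => R) :=
  fun f => set_val f t.

Definition stone_cech : topologicalType := closure (range sc_evaluation).

Definition sc_unit (t : T) : stone_cech :=
  SigSub (mem_set (subset_closure (imageT sc_evaluation t))).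

Definition sc_trace (p : stone_cech) : set_system T :=
  filter_from (nbhs p) (fun U => sc_unit @^-1` U).

End StoneCech.
Arguments unit_functions : clear implicits.

Section StoneCechTheory.
Context (R : realType) (T : topologicalType).
Local Notation bT := (stone_cech R T).
Local Notation eta := (@sc_unit R T).

Lemma sc_coord_continuous (f : unit_functions R T) :
  continuous (fun p : bT => (set_val p : prod_topology _) f : R).
Proof.
move=> p; apply: (@continuous_comp _ _ _ (set_val : bT -> _)
  (fun q : prod_topology (fun _ : unit_functions R T => R) => q f)).
  exact: initial_continuous.
exact: (@proj_continuous _ (fun _ : unit_functions R T => R) f).
Qed.

Lemma sc_unit_continuous : continuous eta.
Proof.
have ev : continuous (@sc_evaluation R T).
  move=> t; apply/cvg_sup => f; apply/cvg_image.
    by rewrite eqEsubset; split => // y _; exists (fun=> y).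
  move=> U nU; have [cf _] := set_valP f.
  exists ((fun q => q f) @^-1` U); first exact: (cf t).
  rewrite eqEsubset; split => [_ [q Uq <-]//|y Uy]; by exists (fun=> y).
apply/continuousP => _ [W oW <-]; move/continuousP: ev => ev.
exact: (ev W oW).
Qed.

Lemma stone_cech_compactum : compactum bT.
Proof.
split.
  pose box := [set q : prod_topology (fun _ : unit_functions R T => R) |
                forall f, `[0, 1]%classic (q f)].
  have cbox : compact box.
    exact: (@tychonoff _ (fun _ : unit_functions R T => R) (fun=> `[0, 1]%classic)
      (fun=> @segment_compact R 0 1)).
  have hP : hausdorff_space (prod_topology (fun _ : unit_functions R T => R)).
    exact: (@hausdorff_product _ (fun _ : unit_functions R T => R)
      (fun=> @Rhausdorff R)).
  have cC : compact (closure (range (@sc_evaluation R T))).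
    apply: (subclosed_compact _ cbox); first exact: closed_closure.
    have /closure_id -> : closed box by exact: compact_closed.
    apply: closureS => _ [t _ <-] f /=.
    by have [_] := set_valP f; move=> /(_ t); rewrite in_itv.
  rewrite compact_ultra => F FU _.
  pose G := (set_val : bT -> _) @ F.
  have GC : G (closure (range (@sc_evaluation R T))).
    by rewrite /G /=; apply: filterE => p; exact: set_valP.
  have [q [Cq clq]] := cC _ (fmap_proper_filter _ (ultra_proper (F := F))) GC.
  exists (SigSub (mem_set Cq)); split => //.
  have : cluster F (SigSub (mem_set Cq) : bT).
    move=> A B FA [_ [[W oW <-] /= Wq WB]].
    have [] := clq (set_val @` A) W.
    - by apply: (@filterS _ F _ A) => //= p Ap; exists p.
    - by apply: open_nbhs_nbhs; split.
    by move=> _ [[p Ap <-] Wp]; exists p; split => //; exact: WB.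
  by rewrite ultra_cvg_clusterE.
move=> p q clpq; apply: val_inj; apply/functional_extensionality_dep => f.
apply: (@Rhausdorff R) => A B nA nB.
have [] := clpq _ _ (sc_coord_continuous (f := f) nA)
                    (sc_coord_continuous (f := f) nB).
by move=> r [Ar Br]; exists ((set_val r : prod_topology _) f).
Qed.

Lemma sc_unit_dense : dense (range eta).
Proof.
move=> E [p Ep] [W oW WE]; have := set_valP p.
have Wp : W (set_val p) by rewrite -WE in Ep.
move=> /(_ W) [|_ [[t _ <-] Wt]]; first by apply: open_nbhs_nbhs; split.
by exists (eta t); split; [rewrite -WE|exists t].
Qed.

Lemma sc_trace_proper (p : bT) : ProperFilter (sc_trace p).
Proof.
apply: filter_from_proper.
  apply: filter_from_filter; first by exists setT; exact: filterT.
  by move=> U V nU nV; exists (U `&` V); first exact: filterI.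
move=> U; rewrite nbhsE => -[V [oV Vp] VU].
have [q [Vq [t _ tE]]] := sc_unit_dense (ex_intro _ p Vp) oV.
by exists t; apply: VU; rewrite tE.
Qed.

Lemma stone_cech_inhabited (p : bT) : exists t : T, True.
Proof.
have [q [_ [t _ _]]] := sc_unit_dense (ex_intro _ p Logic.I) openT.
by exists t.
Qed.

(* The extension of [f : T -> K] to the Stone-Cech compactification, by limits.
   It is meant for [f] continuous and [K] compact Hausdorff, when the limit
   exists and is unique, so that the default value of [xget] plays no role. *)
Definition sc_extension (K : topologicalType) (f : T -> K) (p : bT) : K :=
  xget (f (sval (cid (stone_cech_inhabited p)))) [set x | f @ sc_trace p --> x].

Section Extension.
Context (K : topologicalType) (f : T -> K).
Hypotheses (cK : compactum K) (cf : continuous f).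

Lemma sc_extension_cvg (p : bT) : f @ sc_trace p --> sc_extension f p.
Proof.
have [cptK hK] := cK.
have PF := sc_trace_proper p.
apply: (@xgetPex _ _ [set x | f @ sc_trace p --> x]).
have [x [_ clx]] := cptK (f @ sc_trace p) (fmap_proper_filter _ PF) filterT.
exists x => /= U; rewrite nbhsE => -[V [oV Vx] VU].
have cl1 : closed [set x].
  exact: (accessible_closed_set1 (hausdorff_accessible hK)).
have dis : [set x] `&` ~` V = set0 by rewrite -subset0 => _ [->].
have [phi [cphi rphi phi0 phi1]] : exists phi : K -> R, [/\ continuous phi,
    range phi `<=` `[0, 1], phi @` [set x] `<=` [set 0]
    & phi @` (~` V) `<=` [set 1]].
  apply/uniform_separatorP.
  apply: ((@normal_separatorP R K).1 (compact_normal hK cptK)) => //.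
  exact: open_closedC.
have Pf : unit_functions R T (phi \o f).
  split; first by move=> t; apply: continuous_comp; [exact: cf|exact: cphi].
  by move=> t; have := rphi (phi (f t)) (imageT _ _); rewrite /= in_itv.
pose g : unit_functions R T := SigSub (mem_set Pf).
pose c : R := (set_val p : prod_topology _) g.
have tr A : nbhs c A -> (f @ sc_trace p) (phi @^-1` A).
  move=> nA; exists ((fun q : bT => (set_val q : prod_topology _) g : R) @^-1` A).
    exact: (sc_coord_continuous (f := g)) nA.
  by move=> t.
have c0 : phi x = c.
  apply: (@Rhausdorff R) => A B nA nB.
  have [y [By Ay]] := clx _ _ (tr B nB) (cphi x A nA).
  by exists (phi y).
have : (f @ sc_trace p) (phi @^-1` [set r | r < 1]).
  apply: tr; rewrite -c0 (phi0 (phi x)); last by exists x.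
  by apply: open_nbhs_nbhs; split => /=; [exact: open_lt|exact: ltr01].
apply: filterS => y /= y1; apply: VU; apply: contrapT => nVy.
by move: y1; rewrite (phi1 (phi y)) ?ltxx//; exists y.
Qed.

Lemma sc_extension_continuous : continuous (sc_extension f).
Proof.
have [cptK hK] := cK.
move=> p U nU.
have [V nV VU] : filter_from (nbhs (sc_extension f p)) closure U.
  apply: (compact_regular hK cptK _ nU); exact: filterT.
have [W nW WV] := sc_extension_cvg nV.
have [W' [oW' W'p] W'W] : exists2 W', open_nbhs p W' & W' `<=` W.
  by move: nW; rewrite [nbhs p]nbhsE.
have nW' : nbhs p W' by apply: open_nbhs_nbhs; split.
apply: filterS nW'.
move=> q W'q; apply: VU => B nB.
have PF := sc_trace_proper q.
have W't : sc_trace q (eta @^-1` W').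
  by exists W' => //; apply: open_nbhs_nbhs; split.
have Bq : sc_trace q (f @^-1` B) by exact: (sc_extension_cvg nB).
have [t [Bt W'et]] := filter_ex (filterI Bq W't).
by exists (f t); split => //; apply: WV; exact: W'W.
Qed.

Lemma sc_extension_unit (t : T) : sc_extension f (eta t) = f t.
Proof.
have [_ hK] := cK.
apply: hK => A B nA nB.
have [W nW WA] := sc_extension_cvg nA.
exists (f t); split; last exact: nbhs_singleton.
by apply: WA; exact: (nbhs_singleton nW).
Qed.

Lemma sc_extension_unique (g : bT -> K) :
  continuous g -> (forall t, g (eta t) = f t) -> g = sc_extension f.
Proof.
have [_ hK] := cK.
move=> cg gE; apply/funext => p; apply: hK => A B nA nB.
have PF := sc_trace_proper p.
have At : sc_trace p (f @^-1` A).
  by exists (g @^-1` A); [exact: cg|move=> t /=; rewrite gE].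
have Bt : sc_trace p (f @^-1` B) by exact: (sc_extension_cvg nB).
by have [t [Aft Bft]] := filter_ex (filterI At Bt); exists (f t).
Qed.

End Extension.
End StoneCechTheory.

Section Ultracopower.
Context (R : realType) (X : topologicalType) (I : discreteTopologicalType).
Variable D : set_system I.

(* The point of the Stone-Cech compactification of [I] which an ultrafilter [D]
   on [I] is identified with is the limit of [D] there. *)
Definition ultracopower : topologicalType :=
  [set p : stone_cech R (X * I)%type |
    @sc_unit R I @ D --> sc_extension (@sc_unit R I \o snd) p].

Definition codiagonal (p : ultracopower) : X := sc_extension fst (set_val p).

End Ultracopower.

Definition co_elementary (R : realType) (X Y : topologicalType) (f : X -> Y) :
    Prop :=
  continuous f /\
  exists (I J : discreteTopologicalType) (D : set_system I) (E : set_system J),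
  [/\ UltraFilter D, UltraFilter E &
    exists h : ultracopower R X D -> ultracopower R Y E,
      homeomorphism h /\ f \o @codiagonal R X I D = @codiagonal R Y J E \o h].

Definition co_existential (R : realType) (X Y : topologicalType) (f : X -> Y) :
    Prop :=
  continuous_surjection f /\
  exists (Z : topologicalType) (g : Z -> Y) (h : Z -> X),
    [/\ compactum Z, co_elementary R g, continuous_surjection h & g = f \o h].

Definition co_existentially_closed (R : realType) (X : topologicalType) : Prop :=
  continuum X /\
  forall (Y : topologicalType) (f : Y -> X),
    continuum Y -> continuous_surjection f -> co_existential R f.

(* Main.v *)
Require Import Defs.
From HB Require Import structures.
From mathcomp Require Import all_boot all_order all_algebra.
From mathcomp Require Import finmap.
From mathcomp Require Import mathcomp_extra boolp classical_sets functions.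
From mathcomp Require Import cardinality reals topology normedtype numfun.
From mathcomp Require Import ring lra.

(* Co-existential closedness says that for every continuum [Y] over [X] there
   is a surjection from an ultracopower of [X] to [Y] over [X]. When [Y] lies in
   the product of [X] with a power of the line, it follows that [X] has
   continuous maps to this power whose graphs are in any given neighbourhood of
   [Y] and meet any two given open sets that meet [Y]. We apply this to three
   continua over [X].
   - [X * [0, 1]] shows that [X] has two points, so that dim X > 0.
   - Two copies of [X] joined by an arc at a point [v]: if [X] is the union of
     proper subcontinua [A] and [B] and [v] is not in [A], a close enough map
     separates the connected set [A].
   - The blow-up of [X] along the 1-skeleton of the nerve of a finite closed
     cover, whose fibers are complete graphs: the open stars of the vertices
     pull back to an open cover of multiplicity two. *)

Set Implicit Arguments.
Unset Strict Implicit.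
Unset Printing Implicit Defensive.
Import Order.TTheory GRing.Theory Num.Theory.
Import numFieldNormedType.Exports.

Local Open Scope classical_set_scope.
Local Open Scope ring_scope.

(** * Ultrafilters and maps into products *)

Lemma fmap_ultrafilter (T U : Type) (f : T -> U) (F : set_system T) :
  UltraFilter F -> UltraFilter (f @ F).
Proof.
move=> UF; split; first exact: fmap_proper_filter.
move=> G PG FG; apply/seteqP; split => // A GA.
have [//|FA] := in_ultra_setVsetC (f @^-1` A) UF.
have GC : G (~` A) by exact: FG.
by have [? []] := filter_ex (filterI GA GC).
Qed.

Lemma continuous_pair (S T U : topologicalType) (f : S -> T) (g : S -> U) :
  continuous f -> continuous g -> continuous (fun s => (f s, g s)).
Proof. by move=> cf cg s; apply: cvg_pair; [exact: cf|exact: cg]. Qed.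

Lemma continuous_prod_topology (S : topologicalType) (T : eqType)
    (K : T -> topologicalType) (f : S -> prod_topology K) :
  (forall i, continuous (fun s => f s i)) -> continuous f.
Proof.
move=> cf s; apply/cvg_sup => i; apply/cvg_image.
  rewrite eqEsubset; split => // y _.
  (* Resetting the coordinate [i] of [f s] to [y] shows that the projection to that coordinate is
     onto. *)
  by exists (dfwith (f s) i y) => //; rewrite dfwithin.
move=> U nU; exists ((fun q => q i) @^-1` U); first exact: (cf i s).
rewrite eqEsubset; split => [_ [q Uq <-]//|y Uy].
by exists (dfwith (f s) i y); rewrite /= ?dfwithin.
Qed.

(** * Points of an ultracopower and slices of the Stone-Cech compactification *)

Section UltracopowerPoints.
Context (R : realType) (X : topologicalType) (I : discreteTopologicalType).
Variable D : set_system I.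
Hypothesis UD : UltraFilter D.

Local Notation eta := (@sc_unit R (X * I)%type).
Local Notation index := (sc_extension (@sc_unit R I \o snd)).

(** The carrier of [ultracopower], kept as a set so that its neighbourhoods in the Stone-Cech
    compactification can be discussed. *)
Definition ultracopower_set : set (stone_cech R (X * I)%type) :=
  [set p | @sc_unit R I @ D --> index p].

Let snd_unit_continuous : continuous (@sc_unit R I \o @snd X I).
Proof.
move=> s; apply: continuous_comp; first exact: cvg_snd.
exact: sc_unit_continuous.
Qed.

Let bI := stone_cech_compactum R I.

(** By compactness [D] converges to some point [e] of the compactification of [I], and limits there
    are unique, so the set is the fiber of [index] over [e]. *)
Lemma ultracopower_set_closed : closed ultracopower_set.
Proof.
have [cb hb] := bI.
have := cb; rewrite compact_ultra.
move=> /(_ (@sc_unit R I @ D) (fmap_ultrafilter _ UD) filterT)[e [_ De]].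
have -> : ultracopower_set = index @^-1` [set e].
  apply/seteqP; split => p; last by rewrite /ultracopower_set /= => ->.
  by move=> Dp; apply: (cvg_unique hb Dp De); exact: fmap_proper_filter.
apply: preimage_closed; last exact: accessible_closed_set1 (hausdorff_accessible hb) _.
by move=> p _; exact: sc_extension_continuous bI snd_unit_continuous _.
Qed.

(** The limit [p] exists by compactness. A neighbourhood of [index p] pulls back to a member of [G];
    its trace on [I] lies in [D], since otherwise the complement would lie in [D] and its pullback
    in [G]. *)
Lemma ultracopower_set_limit (G : set_system (X * I)) : UltraFilter G ->
  (forall S, D S -> G (snd @^-1` S)) ->
  exists2 p, ultracopower_set p & eta @ G --> p.
Proof.
move=> UG DG; have [cb _] := stone_cech_compactum R (X * I)%type.
have := cb; rewrite compact_ultra.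
move=> /(_ (eta @ G) (fmap_ultrafilter _ UG) filterT)[p [_ Gp]].
exists p => // V nV; rewrite /= nbhs_filterE.
have GV : G (snd @^-1` (@sc_unit R I @^-1` V)).
  have : G (eta @^-1` (index @^-1` V)).
    exact: Gp (sc_extension_continuous bI snd_unit_continuous nV).
  by apply: filterS => s; rewrite /= (sc_extension_unit _ bI snd_unit_continuous).
have [//|DV] := in_ultra_setVsetC (@sc_unit R I @^-1` V) UD.
by have [? []] := filter_ex (filterI GV (DG _ DV)).
Qed.

(** The indicator of [S] is continuous on the discrete space [I]. Its extension has the value 1 at
    the limit of [D], hence is positive near [index p], and at a point of [I] positivity means
    membership in [S]. *)
Lemma ultracopower_set_trace (p : stone_cech R (X * I)%type) (S : set I) :
  ultracopower_set p -> D S -> sc_trace p (snd @^-1` S).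
Proof.
move=> Wp DS.
pose chi (i : I) : R := (i \in S)%:R.
have chiP : unit_functions R I chi.
  split; first by apply/continuousP => A _; exact: discrete_open.
  by move=> i; rewrite /chi; case: (i \in S); rewrite /= ?lexx ?ler01.
pose g : unit_functions R I := SigSub (mem_set chiP).
pose c (e : stone_cech R I) : R := (set_val e : prod_topology _) g.
have cc : continuous c by exact: sc_coord_continuous.
have cE i : c (sc_unit R i) = chi i by [].
have c1 : c (index p) = 1.
  apply: (@Rhausdorff R) => A B nA nB.
  have DA : D (@sc_unit R I @^-1` (c @^-1` A)) by exact: Wp (cc _ _ nA).
  have [i [/= Ai Si]] := filter_ex (filterI DA DS).
  exists 1; split; last exact: nbhs_singleton.
  by rewrite cE /chi mem_set in Ai.
exists (index @^-1` (c @^-1` [set r | 0 < r])).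
  apply: (sc_extension_continuous bI snd_unit_continuous); apply: cc.
  by rewrite c1; apply: open_nbhs_nbhs; split => /=; [exact: open_gt|exact: ltr01].
move=> [x i] /=; rewrite (sc_extension_unit _ bI snd_unit_continuous) //= cE /chi.
by case: (boolP (i \in S)) => [/set_mem//|_]; rewrite ltxx.
Qed.

(** Otherwise [D]-almost every slice has a point outside [O]. An ultrafilter of such points lying
    over [D] converges to a point of the ultracopower, which is in [O]: a contradiction. *)
Lemma ultracopower_slice_sub (O : set (stone_cech R (X * I)%type)) :
  open O -> ultracopower_set `<=` O -> D [set i | forall x, O (eta (x, i))].
Proof.
move=> oO WO.
have [//|DB] := in_ultra_setVsetC [set i | forall x, O (eta (x, i))] UD.
pose F := filter_from D (fun S => snd @^-1` S `&` eta @^-1` (~` O)).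
have PF : ProperFilter F.
  apply: filter_from_proper.
    apply: filter_from_filter; first by exists setT; exact: filterT.
    move=> S S' DS DS'; exists (S `&` S'); first exact: filterI.
    by move=> s [[]].
  move=> S DS; have [i [Si]] := filter_ex (filterI DS DB).
  by move=> /existsNP[x nO]; exists (x, i).
have [G [UG FG]] := ultraFilterLemma PF.
have [|p Wp Gp] := ultracopower_set_limit UG.
  by move=> S DS; apply: FG; exists S => // ? [].
have GO : G (eta @^-1` O).
  by apply: Gp; apply: open_nbhs_nbhs; split => //; exact: WO.
have GN : G (eta @^-1` (~` O)).
  by apply: FG; exists setT => [|? []//]; exact: filterT.
by have [? []] := filter_ex (filterI GO GN).
Qed.

(** The trace of [p] contains the preimage of [O] and all slices over any given member of [D], so
    the slices that miss [O] cannot form a member of [D]. *)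
Lemma ultracopower_slice_meet (O : set (stone_cech R (X * I)%type)) :
  open O -> (exists2 p, ultracopower_set p & O p) ->
  D [set i | exists x, O (eta (x, i))].
Proof.
move=> oO [p Wp Op].
have [//|DB] := in_ultra_setVsetC [set i | exists x, O (eta (x, i))] UD.
have PF := sc_trace_proper p.
have tO : sc_trace p (eta @^-1` O).
  by exists O => //; apply: open_nbhs_nbhs; split.
have [[x i] [Oxi]] := filter_ex (filterI tO (ultracopower_set_trace Wp DB)).
by case; exists x.
Qed.

Hypothesis cX : compactum X.

Lemma codiagonal_continuous : continuous (@codiagonal R X I D).
Proof.
move=> p; apply: (@continuous_comp _ _ _ (set_val : ultracopower_set -> _)).
  exact: initial_continuous.
by apply: sc_extension_continuous => // s; exact: cvg_fst.
Qed.

(** Copying [D] onto the row of points [(x, i)] and passing to the limit gives a point over [x]. *)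
Lemma codiagonal_surjective (x : X) : exists p, @codiagonal R X I D p = x.
Proof.
pose G := (fun i => (x, i)) @ D.
have UG : UltraFilter G by exact: fmap_ultrafilter.
have [//|p Wp Gp] := ultracopower_set_limit UG.
exists (SigSub (mem_set Wp)); rewrite /codiagonal /=.
have [_ hX] := cX; apply: hX => A B nA nB.
have cfst : continuous (@fst X I) by move=> ?; exact: cvg_fst.
have DA : D [set i | A (sc_extension fst (eta (x, i)))].
  exact: Gp (sc_extension_continuous cX cfst nA).
have [i /=] := filter_ex DA; rewrite (sc_extension_unit _ cX cfst) /= => Ax.
by exists x; split => //; exact: nbhs_singleton.
Qed.

End UltracopowerPoints.

(** * Hausdorff products and subspaces *)

Lemma hausdorff_injection (S T : topologicalType) (f : S -> T) :
  continuous f -> injective f -> hausdorff_space T -> hausdorff_space S.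
Proof.
move=> cf injf hT p q clpq; apply: injf; apply: hT => A B nA nB.
by have [r [Ar Br]] := clpq _ _ (cf _ _ nA) (cf _ _ nB); exists (f r).
Qed.

Lemma hausdorff_pair (S T : topologicalType) :
  hausdorff_space S -> hausdorff_space T -> hausdorff_space (S * T)%type.
Proof.
move=> hS hT [s t] [s' t'] cl; congr (_, _).
  apply: hS => A B nA nB.
  have [||[a b] /= [Aa Ba]] := cl (fst @^-1` A) (fst @^-1` B); last by exists a.
    exact: (@cvg_fst _ _ (nbhs s) (nbhs t) _ _ nA).
  exact: (@cvg_fst _ _ (nbhs s') (nbhs t') _ _ nB).
apply: hT => A B nA nB.
have [||[a b] /= [Aa Ba]] := cl (snd @^-1` A) (snd @^-1` B); last by exists b.
  exact: (@cvg_snd _ _ (nbhs s) (nbhs t) _ _ nA).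
exact: (@cvg_snd _ _ (nbhs s') (nbhs t') _ _ nB).
Qed.

Section SetType.
Context (S : topologicalType) (Y : set S).

Lemma set_val_continuous : continuous (set_val : Y -> S).
Proof. exact: initial_continuous. Qed.

Lemma set_type_compact : compact Y -> compact [set: Y].
Proof.
move=> cY; rewrite compact_ultra => F FU _.
have GU := fmap_ultrafilter (set_val : Y -> S) FU.
have GY : ((set_val : Y -> S) @ F) Y.
  by rewrite /nbhs /=; apply: filterE => p; exact: set_valP.
move: cY; rewrite compact_ultra => /(_ _ GU GY)[q [Yq Fq]].
exists (SigSub (mem_set Yq)); split => // A [_ [[W oW <-] /= Wq WA]].
apply: filterS WA _.
by apply: (Fq W); apply: open_nbhs_nbhs; split.
Qed.

Lemma set_type_connected : connected Y -> connected [set: Y].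
Proof.
move=> cY B [b Bb] [C [W oW WC] BC] [D /closed_openC[W' oW' W'D] BD].
have inB (y : Y) : B y <-> W (set_val y).
  by rewrite BC setTI -WC.
have inB' (y : Y) : B y <-> ~ W' (set_val y).
  rewrite BD setTI -[D]setCK -W'D; split => //.
(* The set [B] is traced on [Y] both by the open [W] and by the closed complement of [W'], so
   connectedness of [Y] applies to the trace. *)
have YW : Y `&` W = Y.
  apply: cY.
  - by exists (set_val b); split; [exact: set_valP|apply/inB].
  - by exists W.
  - exists (~` W'); first exact: open_closedC.
    apply/seteqP; split => s [Ys Hs]; split => //; move: Hs.
      by move=> Ws; apply/(inB' (SigSub (mem_set Ys)))/inB.
    by move=> Ws; apply/(inB (SigSub (mem_set Ys)))/inB'.
apply/seteqP; split => // y _; apply/inB.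
by have := set_valP y; rewrite -{1}YW => -[].
Qed.

End SetType.

(** * From co-existential maps to approximate sections *)

Lemma co_existential_ultracopower (R : realType) (X Y : topologicalType)
    (f : Y -> X) :
  co_existential R f ->
  exists (J : discreteTopologicalType) (E : set_system J)
    (k : ultracopower R X E -> Y),
    [/\ UltraFilter E, continuous k, range k = [set: Y] &
        f \o k = @codiagonal R X J E].
Proof.
move=> [_ [Z [g [h [cZ [_ [I [J [D [E [UD UE eqv]]]]]] [ch rh] gE]]]]].
have [u [[cu [v [cv uK vK]]] gu]] := eqv.
(* The map runs from the ultracopower of [X] back along the homeomorphism to that of [Z], down the
   codiagonal to [Z], and on to [Y] by [h]. *)
exists J, E, (h \o @codiagonal R Z I D \o v); split => //.
- move=> p; apply: continuous_comp; first exact: cv.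
  apply: continuous_comp; first exact: codiagonal_continuous.
  exact: ch.
- apply/seteqP; split => // y _.
  have : range h y by rewrite rh.
  move=> [z _ <-]; have [w <-] := codiagonal_surjective R UD cZ z.
  by exists (u w) => //=; rewrite uK.
- apply/funext => p /=.
  have := congr1 (fun F => F (v p)) gu.
  by rewrite /= vK gE /=.
Qed.

Section Cube.
Context (R : realType) (X : topologicalType) (T : eqType).
Local Notation P := (prod_topology (fun _ : T => R)).

Lemma cube_subset_compact (Y : set (X * P)) : compact [set: X] -> closed Y ->
  (forall q a, Y q -> 0 <= q.2 a <= 1) -> compact Y.
Proof.
move=> cX clY Y01.
have cbox : compact [set r : P | forall a, `[0, 1]%classic (r a)].
  exact: (@tychonoff _ (fun _ : T => R) (fun=> `[0, 1]%classic)
    (fun=> @segment_compact R 0 1)).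
apply: (subclosed_compact clY (compact_setX cX cbox)) => q Yq.
by split => // a; rewrite /= in_itv /=; exact: Y01.
Qed.

Lemma cube_hausdorff : hausdorff_space X -> hausdorff_space (X * P)%type.
Proof.
move=> hX; apply: hausdorff_pair => //.
exact: (@hausdorff_product _ (fun _ : T => R) (fun=> @Rhausdorff R)).
Qed.

Lemma point_continuous : continuous (@fst X P).
Proof. by move=> ?; exact: cvg_fst. Qed.

Lemma coord_continuous a : continuous (fun q : X * P => q.2 a).
Proof.
move=> q; apply: (@continuous_comp _ _ _ snd (fun r : P => r a)).
  exact: cvg_snd.
exact: (@proj_continuous _ (fun _ : T => R) a).
Qed.

Lemma closed_coord a (F : set R) : closed F -> closed [set q : X * P | F (q.2 a)].
Proof. by move/continuous_closedP: (@coord_continuous a); exact. Qed.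

Lemma open_coord a (O : set R) : open O -> open [set q : X * P | O (q.2 a)].
Proof. by move/continuousP: (@coord_continuous a); exact. Qed.

Lemma closed_point (F : set X) : closed F -> closed [set q : X * P | F q.1].
Proof. by move/continuous_closedP: point_continuous; exact. Qed.

Lemma open_point (O : set X) : open O -> open [set q : X * P | O q.1].
Proof. by move/continuousP: point_continuous; exact. Qed.

End Cube.

(* The composite [ultracopower R X E -> Y -> X] is the codiagonal; the Tietze
   extension of the coordinates of the first map to the whole of beta (X * J)
   gives a function on each slice [X * {j}], and the conditions hold for
   [E]-almost all [j]. *)
Lemma approximate_section (R : realType) (X : topologicalType) (T : eqType)
    (Y N N0 N1 : set (X * prod_topology (fun _ : T => R))) :
  co_existentially_closed R X -> compact Y -> connected Y ->
  fst @` Y = [set: X] -> open N -> Y `<=` N ->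
  open N0 -> Y `&` N0 !=set0 -> open N1 -> Y `&` N1 !=set0 ->
  exists phi : X -> prod_topology (fun _ : T => R),
    [/\ continuous phi, forall x, N (x, phi x),
        exists x, N0 (x, phi x) & exists x, N1 (x, phi x)].
Proof.
move=> [[cX _ [x0 _]] closedX] cptY conY fstY oN YN oN0 YN0 oN1 YN1.
have [cptX hX] := cX.
have cfst := @point_continuous R X T.
have proja := @coord_continuous R X T.
pose f (y : Y) : X := (set_val y).1.
have contY : continuum (Y : topologicalType).
  split.
  - split; first exact: set_type_compact.
    apply: (hausdorff_injection (@set_val_continuous _ Y)); first exact: val_inj.
    exact: cube_hausdorff.
  - exact: set_type_connected.
  - have : (fst @` Y) x0 by rewrite fstY.
    by move=> [y Yy _]; exists (SigSub (mem_set Yy)).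
have surjf : continuous_surjection f.
  split.
    move=> y; apply: (@continuous_comp _ _ _ (set_val : Y -> _)).
      exact: set_val_continuous.
    exact: cfst.
  apply/seteqP; split => // x _; have : (fst @` Y) x by rewrite fstY.
  by move=> [y Yy <-]; exists (SigSub (mem_set Yy)).
have [J [E [k [UE ck rk fk]]]] :=
  co_existential_ultracopower (closedX _ f contY surjf).
pose W := @ultracopower_set R X J E.
have [cb hb] := stone_cech_compactum R (X * J)%type.
pose coord a (w : W) : R := (set_val (k w)).2 a.
have ext a : exists g : stone_cech R (X * J)%type -> R, continuous g /\
    forall w : W, g (set_val w) = coord a w.
  have ccoord : continuous (coord a).
    have cka : continuous (fun y : Y => (set_val y).2 a : R).
      move=> y; apply: (@continuous_comp _ _ _ (set_val : Y -> _)
        (fun q : X * prod_topology (fun _ : T => R) => q.2 a)).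
        exact: set_val_continuous.
      exact: proja.
    move=> w; apply: (@continuous_comp _ _ _ k (fun y : Y => (set_val y).2 a : R)).
      exact: ck.
    exact: cka.
  have [M M0 bnd] : exists2 M : R, 0 < M & forall q, Y q -> `|q.2 a| <= M.
    have : compact ((fun q => q.2 a) @` Y).
      by apply: continuous_compact => //; apply: continuous_subspaceT; exact: proja.
    move=> /compact_bounded[M [_ bM]].
    (* The hypothesis [bM] concerns bounds strictly above [M]; this one is also positive, as the
       Tietze extension requires. *)
    exists (`|M| + 1); first by rewrite ltr_wpDl.
    move=> q Yq; apply: bM; last by exists q.
    by rewrite (le_lt_trans (ler_norm M))// ltrDl.
  (* [valL_ 0] gives [coord a] the value 0 off [W]; the extension theorem reads it only on [W]. *)
  have := @continuous_bounded_extension _ R (compact_normal hb cb) W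
    (ultracopower_set_closed UE) (valL_ 0 (coord a)) M M0.
  case.
  - exact/subspace_valL_continuousP'.
  - move=> p Wp.
    have -> : valL_ 0 (coord a) p = coord a (SigSub (mem_set Wp)).
      rewrite -[p in LHS]/(set_val (SigSub (mem_set Wp) : W)).
      by rewrite -[LHS]/(sigL W (valL_ 0 (coord a)) _) valLK.
    by apply: bnd; exact: set_valP.
  - move=> g [gE cg _]; exists g; split=> // w.
    rewrite -gE; last exact: valP.
    by rewrite -[LHS]/(sigL W (valL_ 0 (coord a)) w) valLK.
have [g gP] := choice ext.
(* [Phi] agrees with [k] on the ultracopower, and its restriction to each slice is the graph of a
   map on [X]. *)
pose Phi (p : stone_cech R (X * J)%type) :
  X * prod_topology (fun _ : T => R) := (sc_extension fst p, g^~ p).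
have cfstJ : continuous (@fst X J) by move=> ?; exact: cvg_fst.
have cg : continuous (fun p => g^~ p : prod_topology (fun _ : T => R)).
  by apply: continuous_prod_topology => a; have [] := gP a.
have cPhi : continuous Phi.
  by apply: continuous_pair => //; exact: sc_extension_continuous.
have PhiW (w : W) : Phi (set_val w) = set_val (k w).
  rewrite [RHS]surjective_pairing; congr (_, _).
    by rewrite -[LHS]/(@codiagonal R X J E w) -fk.
  by apply/funext => a; have [_ ->] := gP a.
have Phieta x j : Phi (sc_unit R (x, j)) = (x, g^~ (sc_unit R (x, j))).
  by rewrite /Phi sc_extension_unit.
have sub O : open O -> Y `<=` O ->
    E [set j | forall x, O (x, g^~ (sc_unit R (x, j)))].
  move=> oO YO.
  have oPhi : open (Phi @^-1` O) by move/continuousP: cPhi; exact.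
  have WPhi : W `<=` Phi @^-1` O.
    move=> p Wp; rewrite /= -[p]/(set_val (SigSub (mem_set Wp) : W)) PhiW.
    by apply: YO; exact: set_valP.
  apply: filterS (ultracopower_slice_sub UE oPhi WPhi) => j /= + x.
  by move=> /(_ x); rewrite Phieta.
have meet O : open O -> Y `&` O !=set0 ->
    E [set j | exists x, O (x, g^~ (sc_unit R (x, j)))].
  move=> oO [y [Yy Oy]].
  have oPhi : open (Phi @^-1` O) by move/continuousP: cPhi; exact.
  have WPhi : exists2 p, W p & (Phi @^-1` O) p.
    have : range k (SigSub (mem_set Yy)) by rewrite rk.
    move=> [w _ kw]; exists (set_val (w : W)); first exact: set_valP.
    by rewrite /= PhiW kw.
  apply: filterS (ultracopower_slice_meet UE oPhi WPhi) => j /= [x].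
  by rewrite Phieta; exists x.
have [j [sN [s0 s1]]] := filter_ex
  (filterI (sub N oN YN) (filterI (meet N0 oN0 YN0) (meet N1 oN1 YN1))).
exists (fun x => g^~ (sc_unit R (x, j))); split => //.
move=> x; apply: (@continuous_comp _ _ _ (fun x => sc_unit R (x, j))
  (fun p => g^~ p : prod_topology (fun _ : T => R))); last exact: cg.
apply: (@continuous_comp _ _ _ (fun x => (x, j))); last exact: sc_unit_continuous.
by apply: cvg_pair; [exact: cvg_id|exact: cvg_cst].
Qed.

(** * Connectedness criteria *)

Lemma connected_joined (S : topologicalType) (A : set S) :
  (forall p q, A p -> A q -> connected_component A p q) -> connected A.
Proof.
move=> joined; have [[p Ap]|/forallNP A0] := pselect (exists p, A p).
  have -> : A = connected_component A p; last exact: component_connected.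
  apply/seteqP; split => q; first exact: joined.
  exact: connected_component_sub.
have -> : A = set0 by apply/seteqP; split => // p /A0.
exact: connected0.
Qed.

Lemma path_component (R : realType) (S : topologicalType) (A : set S)
    (c : R -> S) :
  continuous c -> (forall r, 0 <= r <= 1 -> A (c r)) ->
  connected_component A (c 0) (c 1).
Proof.
move=> cc Ac.
have cI : connected (c @` `[0, 1]).
  apply: connected_continuous_connected; first exact: segment_connected.
  exact: continuous_subspaceT.
exists (c @` `[0, 1]); last by exists 1; rewrite //= in_itv /= ler01 lexx.
split=> //; first by exists 0; rewrite //= in_itv /= ler01 lexx.
by move=> _ [r /= + <-]; rewrite in_itv /=; exact: Ac.
Qed.

(** A relatively clopen [B] contains each fiber of [Y] that it meets, so [B] and [Y \ B] have
    disjoint images. These images are compact, hence closed, and cover the connected space [T]; so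
    one of them is empty. *)
Lemma connected_fibers (S T : topologicalType) (Y : set S) (f : S -> T) :
  hausdorff_space T -> connected [set: T] -> continuous f -> compact Y ->
  f @` Y = [set: T] -> hausdorff_space S ->
  (forall t, connected (Y `&` f @^-1` [set t])) -> connected Y.
Proof.
move=> hT cT cf cptY fY hS cfib B [b Bb] [C oC BC] [D cD BD].
have clY : closed Y by exact: compact_closed.
have closed_image F : closed F -> F `<=` Y -> closed (f @` F).
  move=> cF FY; apply: compact_closed => //.
  apply: continuous_compact; first exact: continuous_subspaceT.
  exact: (subclosed_compact cF cptY).
have BY : B `<=` Y by rewrite BC => ? [].
have clB : closed (f @` B).
  by apply: closed_image => //; rewrite BD; exact: closedI.
have clYB : closed (f @` (Y `\` B)).
  apply: closed_image => [|? []//].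
  have -> : Y `\` B = Y `&` ~` C.
    apply/seteqP; split => s [Ys ns]; split => // Cs; apply: ns.
      by rewrite BC.
    by move: Cs; rewrite BC => -[].
  by apply: closedI => //; exact: open_closedC.
have disj t : (f @` B) t -> (f @` (Y `\` B)) t -> False.
  move=> [s Bs fs] [s' [Ys' nBs'] fs'].
  suff E : B `&` (f @^-1` [set t]) = Y `&` f @^-1` [set t].
    have : (Y `&` f @^-1` [set t]) s' by [].
    by rewrite -E => -[].
  apply: (cfib t).
  - by exists s.
  - by exists C => //; rewrite BC setIAC.
  - by exists D => //; rewrite BD setIAC.
have fBT : f @` B = [set: T].
  apply: cT.
  - by exists (f b), b.
  - exists (~` (f @` (Y `\` B))); first exact: closed_openC.
    rewrite setTI; apply/seteqP; split => t; first by move=> tB tN; exact: disj tB tN.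
    move=> nt; have : (f @` Y) t by rewrite fY.
    move=> [s Ys fs]; have [Bs|nBs] := pselect (B s); first by exists s.
    by exfalso; apply: nt; exists s.
  - by exists (f @` B); rewrite ?setTI.
apply/seteqP; split => // s Ys; apply: contrapT => nBs.
apply: (disj (f s)); first by rewrite fBT.
by exists s.
Qed.

Lemma convex_unit_itv (R : realType) (t t' r : R) : 0 <= t <= 1 ->
  0 <= t' <= 1 -> 0 <= r <= 1 -> 0 <= t + r * (t' - t) <= 1.
Proof.
move=> /andP[t0 t1] /andP[t'0 t'1] /andP[r0 r1].
have -> : t + r * (t' - t) = (1 - r) * t + r * t' by ring.
by apply/andP; split; nra.
Qed.

(** * Nondegeneracy and indecomposability *)

Section CoExistentiallyClosed.
Context (R : realType) (X : topologicalType).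
Hypothesis ceX : co_existentially_closed R X.

Local Notation line := (prod_topology (fun _ : unit => R)).

(** [line] is the power of the reals with exponent [unit], the shape to which [approximate_section]
    applies; [height] identifies the reals with it. *)
Let height (t : R) : line := fun=> t.

Let vertical_continuous (x : X) (t t' : R) :
  continuous (fun r : R => (x, height (t + r * (t' - t)))).
Proof.
apply: continuous_pair; first by move=> r; exact: cvg_cst.
apply: continuous_prod_topology => a r; apply: cvgD; first exact: cvg_cst.
by apply: cvgM; [exact: cvg_id|exact: cvg_cst].
Qed.

(** The product of [X] and the unit interval has points below height 1/3 and above 2/3. A map on [X]
    whose graph does too cannot be constant. *)
Lemma co_existentially_closed_nondegenerate : exists x y : X, x <> y.
Proof.
have [[[cX hX] cnX [x0 _]] _] := ceX.
pose Y := [set q : X * line | 0 <= q.2 tt <= 1].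
have clY : closed Y.
  by apply: (@closed_coord _ _ _ tt `[0, 1]%classic); exact: itv_closed.
have cptY : compact Y by apply: cube_subset_compact => // q [].
have fstY : fst @` Y = [set: X].
  by apply/seteqP; split => // x _; exists (x, height 0); rewrite /Y /= ?lexx ?ler01.
have conY : connected Y.
  apply: (@connected_fibers _ _ _ fst) => //; first exact: point_continuous.
    exact: cube_hausdorff.
  move=> x; apply: connected_joined => -[p t] [q t'] /= [Yt /= ->] [Yt' /= ->].
  have tE (s : line) : s = height (s tt) by apply/funext => -[].
  rewrite (tE t) (tE t').
  have := @path_component R _ (Y `&` fst @^-1` [set x]) _
    (@vertical_continuous x (t tt) (t' tt)).
  rewrite mul0r addr0 mul1r subrKC; apply => r r01.
  by split => //; exact: convex_unit_itv.
have [|||||phi [_ _ [x /= px] [y /= py]]] :=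
  @approximate_section R X unit Y setT [set q | q.2 tt < 1 / 3]
    [set q | 2 / 3 < q.2 tt] ceX cptY conY fstY openT.
- by [].
- exact: (@open_coord _ _ _ tt [set r | r < 1 / 3] (@open_lt _ _)).
- by exists (x0, height 0); split; rewrite /Y /height /=; lra.
- exact: (@open_coord _ _ _ tt [set r | 2 / 3 < r] (@open_gt _ _)).
- by exists (x0, height 1); split; rewrite /Y /height /=; lra.
by exists x, y => xy; move: px py; rewrite xy; lra.
Qed.

Lemma co_existentially_closed_indecomposable : indecomposable_continuum X.
Proof.
have [[[cX hX] cnX [x0 _]] _] := ceX.
split; first by case: ceX.
move=> [A [B [[clA cnA _] [clB _ _] nA nB ABT]]].
have AB x : A x \/ B x by have : [set: X] x by []; rewrite -ABT.
have [v nAv] : exists v, ~ A v.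
  by apply/existsNP => AT; apply: nA; apply/seteqP; split=> // x _; exact: AT.
have [u nBu] : exists u, ~ B u.
  by apply/existsNP => BT; apply: nB; apply/seteqP; split=> // x _; exact: BT.
pose Y := [set q : X * line | q.2 tt = 0] `|` [set q | q.2 tt = 1]
  `|` ([set q | q.1 = v] `&` [set q | 0 <= q.2 tt <= 1]).
have clY : closed Y.
  apply: closedU; first apply: closedU.
  - exact: (@closed_coord _ _ _ tt [set r | r = 0] (@closed_eq _ _)).
  - exact: (@closed_coord _ _ _ tt [set r | r = 1] (@closed_eq _ _)).
  apply: closedI; last first.
    by apply: (@closed_coord _ _ _ tt `[0, 1]%classic); exact: itv_closed.
  apply: (@closed_point _ _ _ [set v]).
  exact: accessible_closed_set1 (hausdorff_accessible hX) _.
have cptY : compact Y.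
  apply: cube_subset_compact => // q [] [[]|[]] /=; lra.
have fstY : fst @` Y = [set: X].
  by apply/seteqP; split => // x _; exists (x, height 0) => //; left; left.
have conY : connected Y.
  have horizontal t : t = 0 \/ t = 1 -> forall x,
      connected_component Y (v, height t) (x, height t).
    move=> t01 x; exists ((fun y => (y, height t)) @` [set: X]); last by exists x.
    split; [by exists v| |].
      by move=> _ [y _ <-]; left; case: t01 => ->; [left|right].
    apply: connected_continuous_connected => //; apply: continuous_subspaceT.
    by apply: continuous_pair => y; [exact: cvg_id|exact: cvg_cst].
  have vertical t : 0 <= t <= 1 ->
      connected_component Y (v, height 0) (v, height t).
    move=> t01; have := @path_component R _ Y _ (@vertical_continuous v 0 t).
    rewrite mul0r addr0 mul1r add0r subr0; apply => r r01.
    right; split => //; rewrite /= /height -[t]subr0.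
    by apply: convex_unit_itv; rewrite // lexx ler01.
  (* Every point of [Y] is joined to the foot of the arc; those of the upper copy are reached
     through its top. *)
  have base q : Y q -> connected_component Y (v, height 0) q.
    case: q => x t.
    have -> : t = height (t tt) by apply/funext => -[].
    move=> [[t0|t1]|[/= -> t01]].
    - have -> : t tt = 0 by [].
      by apply: horizontal; left.
    - have -> : t tt = 1 by [].
      apply: (@connected_component_trans _ _ (v, height 1)).
        by apply: vertical; rewrite ler01 lexx.
      by apply: horizontal; right.
    - exact: vertical.
  apply: connected_joined => p q Yp Yq.
  apply: (@connected_component_trans _ _ (v, height 0)); last exact: base.
  by apply: connected_component_sym; exact: base.
(* Since [v] is outside [A], the heights of [Y] over [A] are only 0 and 1, so forbidding the middle
   third over [A] leaves a neighbourhood of [Y]. *)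
pose N := ~` ([set q : X * line | A q.1] `&` [set q | 1 / 3 <= q.2 tt <= 2 / 3]).
have oN : open N.
  apply: closed_openC; apply: closedI; first exact: (@closed_point _ _ _ A).
  by apply: (@closed_coord _ _ _ tt `[1 / 3, 2 / 3]%classic); exact: itv_closed.
have YN : Y `<=` N.
  by move=> q [[/= t0|/= t1]|[/= qv _]] [/= Aq]; [lra|lra|rewrite qv in Aq].
have oB : open (~` B) by exact: closed_openC.
(* Both open sets lie over the complement of [B], hence over [A], and contain points of [Y] over
   [u]. Thus [phi] is low at one point of [A] and high at another. *)
have [|||| phi [cphi Nphi [x [/= nBx px]] [y [/= nBy py]]]] :=
  @approximate_section R X unit Y N
    ([set q | (~` B) q.1] `&` [set q | q.2 tt < 1 / 3])
    ([set q | (~` B) q.1] `&` [set q | 2 / 3 < q.2 tt])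
    ceX cptY conY fstY oN YN.
- apply: openI; first exact: (@open_point _ _ _ (~` B)).
  exact: (@open_coord _ _ _ tt [set r | r < 1 / 3] (@open_lt _ _)).
- by exists (u, height 0); split; [left; left|split => //=; rewrite /height; lra].
- apply: openI; first exact: (@open_point _ _ _ (~` B)).
  exact: (@open_coord _ _ _ tt [set r | 2 / 3 < r] (@open_gt _ _)).
- by exists (u, height 1); split; [left; right|split => //=; rewrite /height; lra].
have Ax : A x by have [] := AB x.
have Ay : A y by have [] := AB y.
have cs : continuous (fun x => phi x tt).
  move=> z; apply: (@continuous_comp _ _ _ phi (fun r : line => r tt)).
    exact: cphi.
  exact: (@proj_continuous _ (fun _ : unit => R) tt).
(* The image of the connected [A] is an interval, so it contains 1/2, which [N] forbids over [A]. *)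
have itvA : is_interval ((fun x => phi x tt) @` A).
  apply/connected_intervalP; apply: connected_continuous_connected => //.
  exact: continuous_subspaceT.
have half : phi x tt <= 1 / 2 <= phi y tt by lra.
have [z Az zE] := itvA _ _ (imageP _ Ax) (imageP _ Ay) _ half.
by apply: (Nphi z); split => //=; rewrite zE; lra.
Qed.

End CoExistentiallyClosed.

(** * Finite closed covers, the nerve blow-up and dimension at most one *)

Lemma card_le2 (T : Type) (S : set T) :
  (forall a b c, S a -> S b -> S c -> [\/ a = b, b = c | a = c]) ->
  (S #<= `I_2)%card.
Proof.
move=> S3; have [[a Sa]|/forallNP S0] := pselect (exists a, S a); last first.
  by have -> : S = set0; [apply/seteqP; split => // a /S0|exact: card_ge0].
have sub b : S b -> (forall c, S c -> c = a \/ c = b) -> (S #<= `I_2)%card.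
  (* [nth b [:: a]] takes 0 to [a] and 1 to its default [b], so it maps [I_2] onto the pair. *)
  move=> Sb Sab; apply: card_le_trans (card_image_le (nth b [:: a]) `I_2).
  apply: subset_card_le => c /Sab[->|->]; first by exists 0%N.
  by exists 1%N.
have [[b [Sb ab]]|/forallNP Sa'] := pselect (exists b, S b /\ a <> b).
  by apply: (sub b) => // c Sc; have [//|<-|<-] := S3 _ _ _ Sa Sb Sc; [right|left].
apply: (sub a) => // c Sc; left; apply: contrapT => ca.
by apply: (Sa' c); split => // /esym.
Qed.

(** By regularity each point has a neighbourhood whose closure lies in a member of [U]; the closures
    of finitely many of these cover [X]. *)
Lemma finite_closed_refinement (X : topologicalType) (U : set (set X)) :
  compactum X -> [set: X] !=set0 -> open_cover U ->
  exists (T : finType) (C : T -> set X),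
    [/\ forall i, closed (C i), forall x, exists i, C i x &
        forall i, exists A, U A /\ C i `<=` A].
Proof.
move=> [cX hX] [x0 _] [oU UT].
(* [PX] is [X] with base point [x0], so that [compact_cover] can be applied. *)
pose PX : ptopologicalType := HB.pack (X : Type) (isPointed.Build X x0) X.
have nearby (x : X) : exists V : set X * set X,
    [/\ nbhs x V.1, closure V.1 `<=` V.2 & U V.2].
  have : (\bigcup_(A in U) A) x by rewrite UT.
  move=> [A UA Ax].
  have nA : nbhs x A by apply: open_nbhs_nbhs; split => //; exact: oU.
  have [V nV VA] : filter_from (nbhs x) closure A.
    by apply: (compact_regular hX cX _ nA); exact: filterT.
  by exists (V, A).
have [V VP] := choice nearby.
have : compact [set: PX] by exact: cX.
rewrite compact_cover => /(_ _ [set: PX] (fun x : X => (V x).1°)).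
case=> [x _|x _|F _ FX]; first exact: open_interior.
  by exists x => //; have [] := VP x.
exists F, (fun i => closure (V (val i)).1); split.
- by move=> i; exact: closed_closure.
- move=> x; have [y Fy Vyx] := FX x Logic.I.
  by exists [` Fy]%fset; apply: subset_closure; exact: interior_subset Vyx.
- by move=> i; have [_ ? ?] := VP (val i); exists (V (val i)).2.
Qed.

(* Over a point [x], this is the 1-skeleton of the full simplex on the indices
   [a] with [C a x], drawn in the boundary of the cube: the maximal coordinate
   is [1], and at most two coordinates are nonzero. *)
Section NerveBlowUp.
Context (R : realType) (X : topologicalType) (T : finType) (C : T -> set X).
Local Notation P := (prod_topology (fun _ : T => R)).

Definition nerve_blowup : set (X * P) :=
  [set q | [/\ forall a, 0 <= q.2 a <= 1, exists a, q.2 a = 1,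
    forall a, q.2 a = 0 \/ C a q.1 &
    forall a b c, a != b -> b != c -> a != c ->
      [\/ q.2 a = 0, q.2 b = 0 | q.2 c = 0]]].

Hypotheses (cX : compactum X) (conX : connected [set: X]).
Hypotheses (clC : forall a, closed (C a)) (covC : forall x, exists a, C a x).

(** All conditions are closed: the universal ones are intersections, and the existence of a
    coordinate 1 is a union over the finite type [T]. *)
Lemma nerve_blowup_compact : compact nerve_blowup.
Proof.
apply: cube_subset_compact => [||q a [] //]; first by case: cX.
have cl0 a : closed [set q : X * P | q.2 a = 0].
  exact: (@closed_coord _ _ _ a [set r | r = 0] (@closed_eq _ _)).
have -> : nerve_blowup =
    (\bigcap_(a in [set: T]) [set q : X * P | 0 <= q.2 a <= 1] `&`
     \bigcup_(a in [set: T]) [set q : X * P | q.2 a = 1]) `&`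
    (\bigcap_(a in [set: T]) ([set q : X * P | q.2 a = 0] `|` [set q | C a q.1]) `&`
     \bigcap_(s in [set s : T * T * T |
         [&& s.1.1 != s.1.2, s.1.2 != s.2 & s.1.1 != s.2]])
       ([set q : X * P | q.2 s.1.1 = 0] `|` [set q | q.2 s.1.2 = 0]
         `|` [set q | q.2 s.2 = 0])).
  apply/seteqP; split => [q [q01 [a qa] qC q3]|q [[q01 [a _ qa]] [qC q3]]].
    split; split; [by move=> b _; exact: q01|by exists a|by move=> b _; exact: qC|].
    move=> [[b c] d] /= /and3P[bc cd bd].
    by have [] := q3 _ _ _ bc cd bd => q0; [left; left|left; right|right].
  split=> [b||b|b c d bc cd bd].
  - exact: q01.
  - by exists a.
  - exact: qC.
  - have [|[]|] := q3 (b, c, d); first by rewrite /= bc cd.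
    + by constructor 1.
    + by constructor 2.
    + by constructor 3.
apply: closedI; apply: closedI.
- apply: closed_bigI => a _.
  by apply: (@closed_coord _ _ _ a `[0, 1]%classic); exact: itv_closed.
- apply: closed_bigcup => [|a _]; first exact: finite_finset.
  exact: (@closed_coord _ _ _ a [set r | r = 1] (@closed_eq _ _)).
- by apply: closed_bigI => a _; apply: closedU => //; exact: (@closed_point _ _ _ (C a)).
- by apply: closed_bigI => s _; apply: closedU => //; exact: closedU.
Qed.

(** The midpoint of the edge between [a] and [b] in the cubical model, where an edge turns a corner
    at (1, 1); [edge a a] is the vertex [a]. *)
Let edge (a b : T) : P := fun c => ((c == a) || (c == b))%:R.

Let edge_blowup x a b : C a x -> C b x -> nerve_blowup (x, edge a b).
Proof.
move=> Ca Cb; split => /= [c||c|c d e]; rewrite /edge.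
- by case: (_ || _); rewrite /= ?lexx ?ler01.
- by exists a; rewrite eqxx.
- case: (boolP ((c == a) || (c == b))) => [|_]; last by left.
  by move=> /orP[] /eqP ->; right.
- move=> cd de ce; case: (boolP ((c == a) || (c == b))) => [cab|_]; last by constructor 1.
  case: (boolP ((d == a) || (d == b))) => [dab|_]; last by constructor 2.
  case: (boolP ((e == a) || (e == b))) => [eab|_]; last by constructor 3.
  exfalso; move: cd de ce.
  by case/orP: cab dab eab => /eqP-> /orP[]/eqP-> /orP[]/eqP->; rewrite ?eqxx.
Qed.

Let fiber x := nerve_blowup `&` fst @^-1` [set x].

(** Shrinking all coordinates but [a] linearly to 0 keeps the coordinate 1 at [a] and creates no new
    nonzero coordinate, so the path stays in the fiber. *)
Let fiber_vertex x t a : fiber x (x, t) -> t a = 1 ->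
  connected_component (fiber x) (x, t) (x, edge a a).
Proof.
move=> [[/= t01 _ tC t3] _] ta.
pose c (r : R) : X * P := (x, fun b => if b == a then 1 else (1 - r) * t b).
have c0 : c 0 = (x, t).
  rewrite /c; congr (_, _); apply/funext => b.
  by have [->|_] := eqVneq b a; rewrite ?subr0 ?mul1r.
have c1 : c 1 = (x, edge a a).
  rewrite /c; congr (_, _); apply/funext => b; rewrite /edge orbb.
  by case: eqVneq => _; rewrite ?subrr ?mul0r.
rewrite -c0 -c1; apply: path_component.
  apply: continuous_pair; first by move=> r; exact: cvg_cst.
  apply: continuous_prod_topology => b r; case: (b == a); first exact: cvg_cst.
  apply: cvgM; last exact: cvg_cst.
  by apply: cvgB; [exact: cvg_cst|exact: cvg_id].
move=> r /andP[r0 r1]; split => //; split=> /= [b||b|b d e bd de be].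
- case: ifP => _; first by rewrite ler01 lexx.
  by have /andP[tb0 tb1] := t01 b; apply/andP; split; nra.
- by exists a; rewrite eqxx.
- case: eqVneq => [->|_].
    by right; have [t0|//] := tC a; have := oner_neq0 R; rewrite -ta t0 eqxx.
  by have [->|] := tC b; [left; rewrite mulr0|right].
- have ta0 : t a <> 0 by rewrite ta; apply/eqP; exact: oner_neq0.
  have zero d' : t d' = 0 -> (if d' == a then 1 else (1 - r) * t d') = 0.
    by case: eqVneq => [->|_ ->]; rewrite ?mulr0.
  by have [/zero|/zero|/zero] := t3 _ _ _ bd de be;
    [constructor 1|constructor 2|constructor 3].
Qed.

(** Each point of a fiber has a coordinate 1 and slides to that vertex; two vertices over [x] are
    joined through the midpoint of their edge. So the fibers are connected, over a connected
    base. *)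
Lemma nerve_blowup_connected : connected nerve_blowup.
Proof.
have [cptX hX] := cX.
apply: (@connected_fibers _ _ _ fst) => //.
- exact: point_continuous.
- exact: nerve_blowup_compact.
- apply/seteqP; split => // x _; have [a Ca] := covC x.
  by exists (x, edge a a) => //; exact: edge_blowup.
- exact: cube_hausdorff.
move=> x; apply: connected_joined.
have vertices a b : C a x -> C b x ->
    connected_component (fiber x) (x, edge a a) (x, edge b b).
  move=> Ca Cb.
  have Fab : fiber x (x, edge a b) by split => //; exact: edge_blowup.
  apply: (@connected_component_trans _ _ (x, edge a b)).
    apply: connected_component_sym; apply: fiber_vertex => //.
    by rewrite /edge eqxx.
  by apply: fiber_vertex => //; rewrite /edge eqxx orbT.
have vertex q : fiber x q ->
    exists2 a, C a x & connected_component (fiber x) q (x, edge a a).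
  case: q => y t Fq; have yx : y = x by case: Fq.
  rewrite yx in Fq *; have [[/= _ [a ta] tC _] _] := Fq; exists a.
    by have [t0|//] := tC a; have := oner_neq0 R; rewrite -ta t0 eqxx.
  exact: fiber_vertex.
move=> p q /vertex[a Ca pa] /vertex[b Cb qb].
apply: connected_component_trans pa _.
apply: connected_component_trans (vertices _ _ Ca Cb) _.
exact: connected_component_sym.
Qed.

Lemma nerve_blowup_surjective : fst @` nerve_blowup = [set: X].
Proof.
apply/seteqP; split => // x _; have [a Ca] := covC x.
by exists (x, edge a a) => //; exact: edge_blowup.
Qed.

End NerveBlowUp.

Lemma co_existentially_closed_dim_le1 (R : realType) (X : topologicalType) :
  co_existentially_closed R X -> covering_multiplicity_le 2 X.
Proof.
move=> ceX U finU covU; have [[cX cnX X0] _] := ceX.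
have [T [C [clC covC CU]]] := finite_closed_refinement cX X0 covU.
have [A AP] := choice CU.
have [oU _] := covU.
have high a : open [set q : X * prod_topology (fun _ : T => R) | 1 / 2 < q.2 a].
  exact: (@open_coord _ _ _ a [set r | 1 / 2 < r] (@open_gt _ _)).
have geh a : closed [set q : X * prod_topology (fun _ : T => R) | 1 / 2 <= q.2 a].
  exact: (@closed_coord _ _ _ a [set r | 1 / 2 <= r] (@closed_ge _ _)).
(* A graph inside [N] has, over each point, some coordinate above 1/2, none reaching 1/2 outside its
   set [A a], and no three reaching 1/2 together. On the blow-up this holds because a coordinate of
   at least 1/2 is nonzero. *)
pose N := \bigcup_(a in [set: T])
    [set q : X * prod_topology (fun _ : T => R) | 1 / 2 < q.2 a] `\`
  (\bigcup_(a in [set: T]) ([set q | (~` A a) q.1] `&` [set q | 1 / 2 <= q.2 a])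
   `|` \bigcup_(s in [set s : T * T * T |
         [&& s.1.1 != s.1.2, s.1.2 != s.2 & s.1.1 != s.2]])
       ([set q | 1 / 2 <= q.2 s.1.1] `&` [set q | 1 / 2 <= q.2 s.1.2]
         `&` [set q | 1 / 2 <= q.2 s.2])).
have oN : open N.
  apply: openI; first by apply: bigcup_open => a _.
  apply: closed_openC; apply: closedU; apply: closed_bigcup => [|a _].
  - exact: finite_finset.
  - apply: closedI => //; apply: (@closed_point _ _ _ (~` A a)).
    by apply: open_closedC; apply: oU; have [] := AP a.
  - exact: finite_finset.
  - by apply: closedI => //; exact: closedI.
have YN : @nerve_blowup R X T C `<=` N.
  move=> q [q01 [a qa] qC q3]; split; first by exists a => //=; rewrite qa; lra.
  move=> [[b _ /= [nAb qb]]|[[[b c] d] /= /and3P[bc cd bd] [[qb qc] qd]]].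
    have [q0|Cb] := qC b; first by lra.
    by apply: nAb; have [_] := AP b; exact.
  by have [] := q3 _ _ _ bc cd bd; lra.
have Y0 : @nerve_blowup R X T C `&` setT !=set0.
  have [x _] := X0; have := nerve_blowup_surjective R covC.
  by move=> /seteqP[_ /(_ x Logic.I)[q Yq _]]; exists q.
have [phi [cphi Nphi _ _]] := approximate_section ceX
  (nerve_blowup_compact cX clC) (nerve_blowup_connected cX cnX clC covC)
  (nerve_blowup_surjective R covC) oN YN openT Y0 openT Y0.
(* These are the preimages of the open stars of the vertices; the three clauses of [N] make them a
   cover, a refinement, and of multiplicity at most two. *)
exists (range (fun a => [set x | 1 / 2 < phi x a])); split.
- exact/finite_image/finite_finset.
- split=> [_ [a _ <-]|].
    have := @continuousP _ _ (fun x => (x, phi x)).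
    move=> [+ _] => /(_ _ _ (high a)); apply.
    by apply: continuous_pair => // x; exact: cvg_id.
  apply/seteqP; split => // x _; have [[a _ xa] _] := Nphi x.
  by exists [set x | 1 / 2 < phi x a] => //; exists a.
- move=> _ [a _ <-]; have [UA _] := AP a; exists (A a) => // x /= xa.
  apply: contrapT => nAx; have [_] := Nphi x; apply; left.
  by exists a => //; split => //=; exact: ltW.
- move=> x; apply: card_le2 => _ _ _ [[a _ <-] /= xa] [[b _ <-] /= xb] [[c _ <-] /= xc].
  have [->|ab] := eqVneq a b; first by constructor 1.
  have [->|bc] := eqVneq b c; first by constructor 2.
  have [->|ac] := eqVneq a c; first by constructor 3.
  have [_] := Nphi x; case; right; exists (a, b, c); first by rewrite /= ab bc.
  by split => /=; [split|]; exact: ltW.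
Qed.

(** * Positive dimension and the conclusion *)

Lemma connected_not_dim_le0 (X : topologicalType) :
  hausdorff_space X -> connected [set: X] -> (exists x y : X, x <> y) ->
  ~ covering_multiplicity_le 1 X.
Proof.
move=> hX cX [x [y xy]] dim0.
have openC1 z : open (~` [set z] : set X).
  exact/closed_openC/accessible_closed_set1/hausdorff_accessible.
have [||V [finV [oV VT] refV multV]] := dim0 [set ~` [set x]; ~` [set y]].
- exact: finite_set2.
- split=> [_ [->|->]//|]; apply/seteqP; split => // z _.
  have [zx|zx] := pselect (z = x); last by exists (~` [set x]) => //; left.
  by exists (~` [set y]); [right|rewrite zx].
have inV z : exists2 B, V B & B z.
  by have : (\bigcup_(B in V) B) z by rewrite VT.
(* Multiplicity one makes the members of [V] pairwise disjoint: an injection into [I_1] takes only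
   the value 0. *)
have uniqV z B B' : V B -> V B' -> B z -> B' z -> B = B'.
  move=> VB VB' Bz B'z; have /pcard_leP[f] := multV z.
  have fB : f B = f B'.
    have := @funS _ _ _ _ f B (conj VB Bz); have := @funS _ _ _ _ f B' (conj VB' B'z).
    by rewrite /= !ltnS !leqn0 => /eqP -> /eqP ->.
  by apply: (@inj _ _ _ f) fB; exact: mem_set.
have [B VB Bx] := inV x.
(* By disjointness the complement of [B] is the union of the other members, so [B] is clopen and
   hence everything, although it must omit [x] or [y]. *)
have BT : B = [set: X].
  apply: cX.
  - by exists x.
  - by exists B; [exact: oV|rewrite setTI].
  - exists (~` \bigcup_(B' in V `\ B) B').
      by apply/open_closedC/bigcup_open => B' [/oV].
    rewrite setTI; apply/seteqP; split => z.
      by move=> Bz [B' [VB' B'B] B'z]; apply: B'B; exact: uniqV B'z Bz.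
    move=> nz; have [B' VB' B'z] := inV z.
    by have [<-//|B'B] := pselect (B' = B); exfalso; apply: nz; exists B'.
by have [_ [->|->]] := refV B VB; rewrite BT => sub; [apply: (sub x)|apply: (sub y)].
Qed.

Theorem theorem4p5 (R : realType) (X : topologicalType) :
  co_existentially_closed R X ->
  indecomposable_continuum X /\ covering_dimension X 1.
Proof.
move=> ceX; have [[[_ hX] cX _] _] := ceX.
split; first exact: co_existentially_closed_indecomposable ceX.
split; first exact: co_existentially_closed_dim_le1 ceX.
apply: connected_not_dim_le0 => //.
exact: co_existentially_closed_nondegenerate ceX.
Qed.
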